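(* Consider the algorithm GRE-SH on a finite parameter set $\Theta$ with $|\Theta|=K$ and a unique optimal parameter $\theta^*$. For any choice of tunable parameters $(\zeta(\theta))_{\theta\in\Theta\setminus\{\theta^*\}}\in\mathbb R^{K-1}$ and any $\alpha>1$, $$\mathbb E R(n)=\sum_{\theta\in\Theta\setminus\{\theta^*\}}\Delta(\theta)\,\mathbb E[T_n(\theta)]\le\Delta(\theta_1)+\sum_{\theta\in\Theta\setminus\{\theta^*\}}\Delta(\theta)\big(a(\theta)+b(\theta)\big),$$ where $$a(\theta)=\mathbb E\left[\sum_{t=2}^n\min\left\{\left(\frac{1}{Q_t(\theta^*,\zeta(\theta))}-1\right)\mathbb P(\theta_t=\theta^*\mid\mathcal H_{t-1}),1\right\}\right],$$ $$b(\theta)=\mathbb E\left[\sum_{t=2}^n\mathbb 1\{Q_t(\theta,\zeta(\theta))>t^{-\alpha}\}\,\mathbb P(\theta_t=\theta\mid\mathcal H_{t-1})\right]+\frac{1}{\alpha-1}.$$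
   Context: Setting: an MDP with trajectories $\tau$ and return $\mathcal R(\tau)\in[0,1]$; each parameter $\theta\in\Theta$ defines a policy $\pi_\theta$ inducing a trajectory distribution $p_\theta$; $J(\theta)=\mathbb E_{\tau\sim p_\theta}[\mathcal R(\tau)]$, $J^*=\max_\theta J(\theta)$, $\Delta(\theta)=J^*-J(\theta)$, and the optimal parameter $\theta^*$ (with $J(\theta^* )=J^*$) is assumed unique. GRE-SH (General Randomized Exploration with Shared History): given initial parameter $\theta_1$, execute $\pi_{\theta_1}$, observe $\tau_1\sim p_{\theta_1}$, and set $\mathcal H_1=\{(\theta_1,\tau_1,\mathcal R(\tau_1))\}$; for $t=2,\dots,n$: for each $\theta\in\Theta$ draw, independently across $\theta$ given $\mathcal H_{t-1}$, a real value $X_t(\theta)\sim q_\theta(\mathcal H_{t-1})$ from a distribution $q_\theta(\mathcal H_{t-1})$ depending on the history; select $\theta_t\in\arg\max_\theta X_t(\theta)$; execute $\pi_{\theta_t}$, observe $\tau_t\sim p_{\theta_t}$, and set $\mathcal H_t=\mathcal H_{t-1}\cup\{(\theta_t,\tau_t,\mathcal R(\tau_t))\}$. Define $Q_t(\theta,\zeta)=\mathbb P(X_t(\theta)\ge\zeta\mid\mathcal H_{t-1})$. $T_n(\theta)=\sum_{t=1}^n\mathbb 1\{\theta_t=\theta\}$ and the regret is $R(n)=\sum_{t=1}^n\Delta(\theta_t)$.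
   Formalization: When Q_t(θ*,ζ(θ)) = 0, where 1/Q_t is undefined, the minimum in a(θ) is taken to be 1, even if P(θ_t=θ*|H_{t-1}) = 0; reading that product as 0 would make the bound false. *)

(* Defs.v *)
From HB Require Import structures.
From mathcomp Require Import all_boot all_order all_algebra.
From mathcomp Require Import all_classical all_reals all_analysis.
Set Implicit Arguments. Unset Strict Implicit. Unset Printing Implicit Defensive.
Import Order.TTheory GRing.Theory Num.Def Num.Theory.
Local Open Scope classical_set_scope.
Local Open Scope ring_scope.

(* Sets of the sample space Omega that are "observable from the history"
   H_t = {(theta_s, tau_s, R(tau_s)) : 1 <= s <= t}: preimages under theta_s
   (Theta finite, discrete), under tau_s of measurable sets of trajectories,
   and under R(tau_s) of Borel sets. *)
Definition hist_gen {R : realType} {d dO} {Theta : Type}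
  {T : measurableType d} {Omega : measurableType dO}
  (Rw : T -> R) (th : nat -> Omega -> Theta) (tau : nat -> Omega -> T)
  (t : nat) : set_system Omega :=
  [set A | exists s, (1 <= s <= t)%N /\
     ((exists B : set Theta, A = th s @^-1` B) \/
      (exists C : set T, measurable C /\ A = tau s @^-1` C) \/
      (exists C : set R, measurable C /\ A = (Rw \o tau s) @^-1` C))].

Definition hist_sigma {R : realType} {d dO} {Theta : Type}
  {T : measurableType d} {Omega : measurableType dO}
  (Rw : T -> R) (th : nat -> Omega -> Theta) (tau : nat -> Omega -> T)
  (t : nat) : set_system Omega :=
  <<s hist_gen Rw th tau t >>.

(* sigma(H_{t-1}, X_t, theta_t) (for t >= 2), resp. sigma(theta_1) for t = 1:
   the information available just before tau_t is drawn. *)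
Definition pre_tau_sigma {R : realType} {d dO} {Theta : Type}
  {T : measurableType d} {Omega : measurableType dO}
  (Rw : T -> R) (th : nat -> Omega -> Theta) (tau : nat -> Omega -> T)
  (X : nat -> Theta -> Omega -> R) (t : nat) : set_system Omega :=
  <<s hist_gen Rw th tau t.-1
      `|` [set A | (2 <= t)%N /\ exists i (C : set R),
                   measurable C /\ A = X t i @^-1` C]
      `|` [set A | exists B : set Theta, A = th t @^-1` B] >>.

Definition meas_wrt {dO} {Omega : measurableType dO} {R : realType}
  (G : set_system Omega) (f : Omega -> R) : Prop :=
  forall B : set R, measurable B -> G (f @^-1` B).

Definition Jval {R : realType} {d} {Theta : Type} {T : measurableType d}
  (p : Theta -> probability T R) (Rw : T -> R) (th : Theta) : R :=
  fine (\int[p th]_tau (Rw tau)%:E)%E.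

(* Main.v *)
Require Import Defs.
From HB Require Import structures.
From mathcomp Require Import all_boot all_order all_algebra.
From mathcomp Require Import all_classical all_reals all_analysis.
From mathcomp Require Import measurable_realfun.
Import Order.TTheory GRing.Theory Num.Def Num.Theory.
Local Open Scope classical_set_scope.
Local Open Scope ring_scope.

(** Fix a round [t >= 2], a suboptimal [i] and [z = zeta i], and let [N] be the
    conditional probability that [X_t j < z] for every [j <> thstar].
    If [theta_t = i] and [X_t i < z], then all scores are below [z], an event
    of conditional probability [(1 - q) N], with [q = Q_t thstar z]; if the
    score of [thstar] is at least [z] and all others are below it, then
    [thstar] is selected, so
    [q N <= P(theta_t = thstar | H_(t-1))] almost surely.  Together these give
    the terms of [a].  If [theta_t = i] and [X_t i >= z], split on whether
    [Q_t i z > t^-alpha]: the history event contributes the terms of [b], its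
    complement at most [t^-alpha], and these sum to at most
    [1 / (alpha - 1)]. *)

Lemma powRN_le_telescope {R : realType} (alpha : R) (t : nat) :
  1 < alpha -> (0 < t)%N ->
  (alpha - 1) * t.+1%:R `^ (- alpha) <=
    t%:R `^ (1 - alpha) - t.+1%:R `^ (1 - alpha).
Proof.
move=> a1 t0.
have tp : 0 < t%:R :> R by rewrite ltr0n.
have sp : 0 < t.+1%:R :> R by rewrite ltr0n.
have -> : t.+1%:R `^ (1 - alpha) = t.+1%:R * t.+1%:R `^ (- alpha) :> R.
  by rewrite powRD ?(gt_eqF sp) ?implybT// powRr1 ?ltW.
have ratio : t%:R = t.+1%:R * (1 + - t.+1%:R^-1) :> R.
  by rewrite mulrDr mulrN mulfV ?gt_eqF// mulr1 -natr1 addrK.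
have rp : 0 < 1 + - t.+1%:R^-1 :> R by rewrite -(pmulr_rgt0 _ sp) -ratio.
have -> : t%:R `^ (1 - alpha) =
    t.+1%:R * t.+1%:R `^ (- alpha) * (1 + - t.+1%:R^-1) `^ (1 - alpha) :> R.
  rewrite {1}ratio powRM ?ltW//; congr (_ * _).
  by rewrite powRD ?(gt_eqF sp) ?implybT// powRr1 ?ltW.
(* Bernoulli, from [1 + x <= expR x] and [ln (1 + x) <= x] *)
have bern : 1 + (alpha - 1) / t.+1%:R <= (1 + - t.+1%:R^-1) `^ (1 - alpha) :> R.
  rewrite /powR gt_eqF// (le_trans _ (expR_ge1Dx _))// lerD2l.
  rewrite -(opprB alpha) mulNr -mulrN ler_wpM2l ?subr_ge0 ?(ltW a1)//.
  by rewrite lerNr le_ln1Dx// ltrN2 -subr_gt0.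
have wp : 0 <= t.+1%:R * t.+1%:R `^ (- alpha) :> R.
  by rewrite mulr_ge0 ?powR_ge0.
set u := _ * (_ `^ _) in wp *.
have -> : forall v, u * v - u = u * (v - 1) by move=> v; rewrite mulrBr mulr1.
apply: (@le_trans _ _ (u * ((alpha - 1) / t.+1%:R))).
  by rewrite /u mulrACA [leRHS]mulrC [leRHS]mulrA divfK ?gt_eqF// mulrC.
by rewrite ler_wpM2l// lerBrDl.
Qed.

Lemma sum_powRN_le {R : realType} (alpha : R) (n : nat) :
  1 < alpha ->
  \sum_(2 <= t < n.+1) (t%:R : R) `^ (- alpha) <= (alpha - 1)^-1.
Proof.
move=> a1; have a0 : 0 < alpha - 1 by rewrite subr_gt0.
case: n => [|n]; first by rewrite big_geq// invr_ge0 ltW.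
suff H : (alpha - 1) * \sum_(2 <= t < n.+2) (t%:R : R) `^ (- alpha) <=
    1 - n.+1%:R `^ (1 - alpha).
  by rewrite -(ler_pM2l a0) mulfV ?gt_eqF// (le_trans H)//.
rewrite big_add1 /= mulr_sumr.
apply: (@le_trans _ _ (\sum_(1 <= t < n.+1)
    (t%:R `^ (1 - alpha) - t.+1%:R `^ (1 - alpha)))).
  by apply: ler_sum_nat => t /andP[t0 _]; exact: powRN_le_telescope.
by rewrite (telescope_sumr_eq (fun t => - (t%:R : R) `^ (1 - alpha)))//
  ?powR1 => [|t _]; rewrite ?opprK addrC.
Qed.

Lemma meas_wrt_gen {dO} {Omega : measurableType dO} {R : realType}
    {G : set_system Omega} {f : Omega -> R} :
  meas_wrt <<s G >> f <-> measurable_fun [set: g_sigma_algebraType G] f.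
Proof.
split=> [mf _ B mB|mf B mB]; first by rewrite setTI; exact: mf.
by have := mf measurableT B mB; rewrite setTI.
Qed.

Lemma meas_wrt_measurable {dO} {Omega : measurableType dO} {R : realType}
    {G : set_system Omega} {f : Omega -> R} :
  G `<=` measurable -> meas_wrt G f -> measurable_fun setT f.
Proof. by move=> sG mf _ B mB; rewrite setTI; exact/sG/mf. Qed.

Lemma ae_le_integral_lt_set {d} {T : measurableType d} {R : realType}
    (mu : measure T R) (f g : T -> R) (A := [set x | g x < f x]) :
  measurable_fun setT f -> measurable_fun setT g -> (forall x, 0 <= g x) ->
  (\int[mu]_(x in A) (g x)%:E < +oo)%E ->
  (\int[mu]_(x in A) (f x)%:E <= \int[mu]_(x in A) (g x)%:E)%E ->
  \forall x \ae mu, f x <= g x.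
Proof.
move=> mf mg g0 gfin fg.
have mA : measurable A.
  rewrite -[A]setTI.
  exact: (measurable_fun_ltr mg mf measurableT (Y := [set true])).
pose h x := f x - g x.
have mh : measurable_fun A (EFin \o h).
  by apply/measurable_EFinP/measurable_funTS/measurable_funB.
have h0 x : A x -> (0 <= (EFin \o h) x)%E.
  by move=> Ax; rewrite lee_fin subr_ge0 ltW.
have splitf : (\int[mu]_(x in A) (f x)%:E =
    \int[mu]_(x in A) (g x)%:E + \int[mu]_(x in A) (h x)%:E)%E.
  rewrite -ge0_integralD//; last 2 first.
  - by move=> x _; rewrite lee_fin.
  - by apply/measurable_EFinP/measurable_funTS.
  by apply: eq_integral => x _; rewrite -EFinD /h addrC subrK.
have int0 : (\int[mu]_(x in A) (h x)%:E = 0)%E.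
  apply/eqP; rewrite eq_le integral_ge0// andbT.
  rewrite -(@leeD2lE _ (\int[mu]_(x in A) (g x)%:E)%E) ?adde0 -?splitf//.
  by rewrite ge0_fin_numE// integral_ge0// => x _; rewrite lee_fin.
have /(ae_eq_integral_abs mu mA mh) : (\int[mu]_(x in A)
    `|(EFin \o h) x| = 0)%E.
  by rewrite -int0; apply: eq_integral => x /set_mem Ax; rewrite gee0_abs// h0.
apply: filterS => x fgx; rewrite leNgt; apply/negP => ltgf.
by have [/eqP] := fgx ltgf; rewrite subr_eq0 gt_eqF.
Qed.

Lemma fine_probability_ge0_le1 {d} {T : measurableType d} {R : realType}
    (mu : probability T R) (B : set T) :
  measurable B -> 0 <= fine (mu B) <= 1.
Proof.
move=> mB; rewrite fine_ge0//= -lee_fin fineK ?probability_le1//.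
exact: fin_num_measure.
Qed.

Lemma fine_probability_lt_itv {R : realType} (mu : probability R R) (z : R) :
  fine (mu `]-oo, z[%classic) = 1 - fine (mu `[z, +oo[%classic).
Proof.
rewrite -setCitvr probability_setC// fineB//; exact: fin_num_measure.
Qed.

Lemma measurable_inv_ge0 {d} {T : measurableType d} {R : realType}
    (f : T -> R) :
  (forall x, 0 <= f x) -> measurable_fun setT f ->
  measurable_fun setT (fun x => (f x)^-1).
Proof.
move=> f0 mf; under eq_fun do rewrite -powR_inv1//.
exact: measurableT_comp (measurable_powR _) mf.
Qed.

Lemma measurable_min_odds {d} {T : measurableType d} {R : realType}
    (f g : T -> R) :
  (forall x, 0 <= f x) -> measurable_fun setT f -> measurable_fun setT g ->
  measurable_fun setT
    (fun x => if f x == 0 then 1 else Num.min (((f x)^-1 - 1) * g x) 1).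
Proof.
move=> f0 mf mg; apply: measurable_fun_ifT.
- by apply: measurable_fun_eqr => //; exact: measurable_cst.
- exact: measurable_cst.
apply: measurable_minr; last exact: measurable_cst.
apply: measurable_funM => //; apply: measurable_funB; last exact: measurable_cst.
exact: measurable_inv_ge0.
Qed.

Lemma min_odds_ge0 {R : realType} (x y : R) : 0 <= x <= 1 -> 0 <= y ->
  0 <= (if x == 0 then 1 else Num.min ((x^-1 - 1) * y) 1).
Proof.
case/andP=> x0 x1 y0; case: eqVneq => // xn0.
rewrite le_min ler01 andbT mulr_ge0// subr_ge0 invf_ge1//.
by rewrite lt_neqAle eq_sym xn0.
Qed.

Section selection.
Context {R : realType} {Theta : finType} {dO : measure_display}
  {Omega : measurableType dO} (P : probability Omega R) (G : set_system Omega)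
  (q : Theta -> Omega -> probability R R) (X : Theta -> Omega -> R)
  (th : Omega -> Theta) (pc : Theta -> Omega -> R).
Hypothesis sG : <<s G >> `<=` measurable.
Hypothesis mX : forall j, measurable_fun setT (X j).
Hypothesis mth : forall B : set Theta, measurable (th @^-1` B).
Hypothesis mq : forall j (B : set R), measurable B ->
  meas_wrt <<s G >> (fun w => fine (q j w B)).
Hypothesis indep : forall (A : set Omega) (B : Theta -> set R),
  <<s G >> A -> (forall j, measurable (B j)) ->
  P (A `&` \bigcap_(j in [set: Theta]) (X j @^-1` B j)) =
  (\int[P]_(w in A) (\prod_(j : Theta) fine (q j w (B j)))%:E)%E.
Hypothesis argmax : forall w j, X j w <= X (th w) w.
Hypothesis mpc : forall j, meas_wrt <<s G >> (pc j).
Hypothesis pc01 : forall j w, 0 <= pc j w <= 1.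
Hypothesis pcE : forall j A, <<s G >> A ->
  (\int[P]_(w in A) (pc j w)%:E)%E = P (A `&` th @^-1` [set j]).

Let Q j z w := fine (q j w `[z, +oo[%classic).

Let QE j z w : fine (q j w `]-oo, z[%classic) = 1 - Q j z w.
Proof. exact: fine_probability_lt_itv. Qed.

Let Q01 j z w : 0 <= Q j z w <= 1.
Proof. exact: fine_probability_ge0_le1. Qed.

Let mQ j z : measurable_fun setT (Q j z).
Proof. by apply: (meas_wrt_measurable sG); exact: mq. Qed.

Let mQG j z : measurable_fun [set: g_sigma_algebraType G] (Q j z).
Proof. by apply/(meas_wrt_gen (f := Q j z)); exact: mq. Qed.

Let mpcT j : measurable_fun setT (pc j).
Proof. exact: (meas_wrt_measurable sG). Qed.

Let mG {A} : <<s G >> A -> measurable A. Proof. exact: sG. Qed.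

Let GT : <<s G >> [set: Omega].
Proof. exact: (@measurableT _ (g_sigma_algebraType G)). Qed.

Let others (s : Theta) z w := \prod_(j | j != s) (1 - Q j z w).

Let others01 s z w : 0 <= others s z w <= 1.
Proof.
have Qc01 j : 0 <= 1 - Q j z w <= 1.
  by have /andP[Q0 Q1] := Q01 j z w; rewrite subr_ge0 Q1 gerBl.
by rewrite /others prodr_ge0 ?prodr_ile1// => j _; case/andP: (Qc01 j).
Qed.

Let mothers s z : meas_wrt <<s G >> (others s z).
Proof.
apply/meas_wrt_gen.
rewrite (_ : others s z = fun w =>
    \prod_j (if j != s then 1 - Q j z w else 1)); last first.
  by apply/funext => w; rewrite /others big_mkcond.
apply: measurable_prod => j _; case: (j != s); last exact: measurable_cst.
apply: measurable_funB; first exact: measurable_cst.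
exact: mQG.
Qed.

Let Q_others_le_pc s z : \forall w \ae P, Q s z w * others s z w <= pc s w.
Proof.
have mQo : meas_wrt <<s G >> (fun w => Q s z w * others s z w).
  apply/meas_wrt_gen/measurable_funM; [exact: mQG | exact/meas_wrt_gen].
have GA : <<s G >> [set w | pc s w < Q s z w * others s z w].
  have := measurable_fun_ltr (iffLR meas_wrt_gen (mpc s))
    (iffLR meas_wrt_gen mQo) measurableT (Y := [set true]).
  by rewrite setTI; exact.
apply: ae_le_integral_lt_set.
- exact: (meas_wrt_measurable sG).
- exact: mpcT.
- by move=> w; case/andP: (pc01 s w).
- rewrite pcE// (le_lt_trans (probability_le1 _ _)) ?ltry//.
  by apply: measurableI; [exact: mG | exact: mth].
rewrite pcE//.
pose B j : set R := if j == s then `[z, +oo[%classic else `]-oo, z[%classic.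
have mB j : measurable (B j) by rewrite /B; case: ifP.
have -> : (\int[P]_(w in [set w | (pc s w < Q s z w * others s z w)%R])
      (Q s z w * others s z w)%:E =
    \int[P]_(w in [set w | (pc s w < Q s z w * others s z w)%R])
      (\prod_j fine (q j w (B j)))%:E)%E.
  apply: eq_integral => w _; rewrite (bigD1 s)//= /B eqxx.
  congr (_ * _)%:E; apply: eq_bigr => j /negbTE ->; exact/esym/QE.
rewrite -indep// le_measure ?inE//.
- apply: measurableI; first exact: mG.
  apply: fin_bigcap_measurable => // j _; rewrite -[_ @^-1` _]setTI; exact: mX.
- by apply: measurableI; [exact: mG | exact: mth].
apply: setIS => w wB /=; apply/eqP; apply: contraT => ths.
have := wB s I; rewrite /preimage /= /B eqxx /= in_itv/= andbT => zXs.
have := wB (th w) I; rewrite /preimage /= /B (negbTE ths) /= in_itv/= => Xz.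
by have := le_lt_trans (le_trans zXs (argmax w s)) Xz; rewrite ltxx.
Qed.

Lemma selected_lt_prob_le s i z :
  (P (th @^-1` [set i] `&` X i @^-1` `]-oo, z[%classic) <=
   \int[P]_w (if Q s z w == 0 then 1
              else Num.min (((Q s z w)^-1 - 1) * pc s w) 1)%:E)%E.
Proof.
have step : (P (th @^-1` [set i] `&` X i @^-1` `]-oo, z[%classic) <=
    \int[P]_w ((1 - Q s z w) * others s z w)%:E)%E.
  have -> : (\int[P]_w ((1 - Q s z w) * others s z w)%:E =
      \int[P]_w (\prod_j fine (q j w `]-oo, z[%classic))%:E)%E.
    apply: eq_integral => w _; rewrite (bigD1 s)//= QE.
    by congr (_ * _)%:E; apply: eq_bigr => j _; exact/esym/QE.
  rewrite -(indep setT (fun=> `]-oo, z[%classic) GT)// setTI le_measure ?inE//.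
  - apply: measurableI => //; rewrite -[_ @^-1` _]setTI; exact: mX.
  - apply: fin_bigcap_measurable => // j _; rewrite -[_ @^-1` _]setTI; exact: mX.
  move=> w [/= <-]; rewrite in_itv/= => Xz j _ /=.
  by rewrite in_itv/=; exact: le_lt_trans (argmax w j) Xz.
apply: (le_trans step); apply: ae_ge0_le_integral => //.
- move=> w _; rewrite lee_fin mulr_ge0//; last by case/andP: (others01 s z w).
  by rewrite subr_ge0; case/andP: (Q01 s z w).
- apply/measurable_EFinP/measurable_funM; last exact: (meas_wrt_measurable sG).
  by apply: measurable_funB => //; exact: measurable_cst.
- by move=> w _; rewrite lee_fin min_odds_ge0//; case/andP: (pc01 s w).
- apply/measurable_EFinP/measurable_min_odds => // w.
  by case/andP: (Q01 s z w).
apply: filterS (Q_others_le_pc s z) => w Qpc _; rewrite lee_fin.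
have /andP[Qge Qle] := Q01 s z w; have /andP[oge ole] := others01 s z w.
have le1 : (1 - Q s z w) * others s z w <= 1.
  by rewrite mulr_ile1// ?subr_ge0// gerBl.
case: eqVneq => // Q0; rewrite le_min le1 andbT.
have -> : (Q s z w)^-1 - 1 = (1 - Q s z w) / Q s z w.
  by rewrite mulrBl mul1r divff.
have Qp : 0 < Q s z w by rewrite lt_neqAle eq_sym Q0.
by rewrite -mulrA ler_wpM2l ?subr_ge0// mulrC ler_pdivlMr// mulrC.
Qed.

Lemma selected_ge_prob_le i z (c : R) : 0 <= c ->
  (P (th @^-1` [set i] `&` X i @^-1` `[z, +oo[%classic) <=
   \int[P]_w (if c < Q i z w then pc i w else 0)%:E + c%:E)%E.
Proof.
move=> c0; pose A := [set w | c < Q i z w].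
have mc : measurable_fun [set: g_sigma_algebraType G] (fun=> c).
  exact: measurable_cst.
have GA : <<s G >> A.
  have := measurable_fun_ltr mc (mQG i z) measurableT (Y := [set true]).
  by rewrite setTI; exact.
have GnA : <<s G >> (~` A) by exact: (@measurableC _ (g_sigma_algebraType G)).
have mA := mG GA; have mnA := mG GnA.
have mXz : measurable (X i @^-1` `[z, +oo[%classic).
  by rewrite -[_ @^-1` _]setTI; exact: mX.
have -> : (\int[P]_w (if c < Q i z w then pc i w else 0)%:E =
    P (A `&` th @^-1` [set i]))%E.
  rewrite -pcE// [RHS]integral_mkcond; apply: eq_integral => w _.
  rewrite patchE; case: ifPn => cQ; first by rewrite mem_set.
  by rewrite memNset//; exact/negP.
have lec : (P (~` A `&` X i @^-1` `[z, +oo[%classic) <= c%:E)%E.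
  pose B j : set R := if j == i then `[z, +oo[%classic else setT.
  have mB j : measurable (B j) by rewrite /B; case: ifP.
  have -> : ~` A `&` X i @^-1` `[z, +oo[%classic =
      ~` A `&` \bigcap_(j in [set: Theta]) (X j @^-1` B j).
    congr (_ `&` _); apply/seteqP; split=> [w Xw j _|w /(_ i I)].
      by rewrite /= /B; case: eqP => // ->.
    by rewrite /= /B eqxx.
  rewrite indep//; apply: (@le_trans _ _ (\int[P]_(w in ~` A) c%:E)%E).
    apply: ge0_le_integral => //.
    - by move=> w _; rewrite lee_fin prodr_ge0// => j _; rewrite fine_ge0.
    - apply/measurable_EFinP/measurable_funTS/measurable_prod => j _.
      by apply: (meas_wrt_measurable sG); exact: mq.
    move=> w /negP; rewrite -leNgt lee_fin (bigD1 i)//= /B eqxx big1 ?mulr1//.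
    by move=> j /negbTE ->; rewrite probability_setT.
  rewrite integral_cst//= -[leRHS]mule1 lee_wpmul2l ?lee_fin//.
  exact: probability_le1.
apply: (@le_trans _ _ (P ((A `&` th @^-1` [set i]) `|`
                          (~` A `&` X i @^-1` `[z, +oo[%classic)))).
  rewrite le_measure ?inE//; first exact: measurableI.
    by apply: measurableU; exact: measurableI.
  by move=> w [thw Xw]; have [Aw|nAw] := pselect (A w); [left|right].
apply: (le_trans (measureU2 _ _ _)); [exact: measurableI..|].
by rewrite leeD2l.
Qed.

Lemma selected_prob_le s i z (c : R) : 0 <= c ->
  (P (th @^-1` [set i]) <=
   \int[P]_w (if Q s z w == 0 then 1
              else Num.min (((Q s z w)^-1 - 1) * pc s w) 1)%:E +
   (\int[P]_w (if c < Q i z w then pc i w else 0)%:E + c%:E))%E.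
Proof.
move=> c0.
have mXz (I : interval R) : measurable (X i @^-1` [set` I]).
  by rewrite -[_ @^-1` _]setTI; exact: mX.
have -> : th @^-1` [set i] =
    (th @^-1` [set i] `&` X i @^-1` `]-oo, z[%classic) `|`
    (th @^-1` [set i] `&` X i @^-1` `[z, +oo[%classic).
  by rewrite -setIUr -preimage_setU -setCitvr setvU preimage_setT setIT.
apply: (le_trans (measureU2 _ _ _)); [exact: measurableI..|].
by rewrite leeD ?selected_lt_prob_le ?selected_ge_prob_le.
Qed.

End selection.

Lemma ge0_integral_sum_nat {d} {T : measurableType d} {R : realType}
    (mu : measure T R) (m n : nat) (f : nat -> T -> R) :
  (forall t, (m <= t)%N -> measurable_fun setT (f t)) ->
  (forall t x, (m <= t)%N -> 0 <= f t x) ->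
  (\int[mu]_x (\sum_(m <= t < n) f t x)%:E =
   \sum_(m <= t < n) \int[mu]_x (f t x)%:E)%E.
Proof.
move=> mf f0; rewrite -[m]add0n !big_addn.
under eq_integral do rewrite big_addn -sumEFin.
rewrite ge0_integral_sum// => [t|t x _].
  by apply/measurable_EFinP/mf; rewrite leq_addl.
by rewrite lee_fin f0// leq_addl.
Qed.

Lemma indicator_preimage1 {T : Type} {I : eqType} {R : realType}
    (f : T -> I) i : (fun x => (f x == i)%:R) = \1_(f @^-1` [set i]) :> (T -> R).
Proof.
apply/funext => x; rewrite indicE; congr (nat_of_bool _)%:R.
by apply/eqP/idP => [fx|/set_mem//]; apply/mem_set.
Qed.

Lemma hist_sigma_measurable {R : realType} {d dO} {Theta : Type}
    {T : measurableType d} {Omega : measurableType dO}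
    (Rw : T -> R) (th : nat -> Omega -> Theta) (tau : nat -> Omega -> T) t :
  measurable_fun setT Rw -> (forall s, measurable_fun setT (tau s)) ->
  (forall s (B : set Theta), measurable (th s @^-1` B)) ->
  hist_sigma Rw th tau t `<=` measurable.
Proof.
move=> mRw mtau mth; apply: smallest_sub; first exact: sigma_algebra_measurable.
move=> A [s [_ [[B ->]|[[C [mC ->]]|[C [mC ->]]]]]]; first exact: mth.
  by rewrite -[_ @^-1` _]setTI; exact: mtau.
have mc : measurable_fun setT (Rw \o tau s) by exact: measurableT_comp.
by rewrite -[_ @^-1` _]setTI; exact: mc.
Qed.

Theorem theorem6
  (R : realType) (Theta : finType)
  (d : measure_display) (T : measurableType d)
  (Rw : T -> R) (p : Theta -> probability T R)
  (thstar : Theta) (theta1 : Theta)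
  (dO : measure_display) (Omega : measurableType dO) (P : probability Omega R)
  (q : nat -> Theta -> Omega -> probability R R)
  (X : nat -> Theta -> Omega -> R)
  (th : nat -> Omega -> Theta) (tau : nat -> Omega -> T)
  (pc : nat -> Theta -> Omega -> R)
  (zeta : Theta -> R) (alpha : R) (n : nat) :
  (* the return: measurable, with values in [0,1] *)
  measurable_fun setT Rw ->
  (forall tr, 0 <= Rw tr <= 1) ->
  (* thstar is the unique optimal parameter *)
  (forall i, Jval p Rw i <= Jval p Rw thstar) ->
  (forall i, Jval p Rw i = Jval p Rw thstar -> i = thstar) ->
  (* measurability of the random quantities *)
  (forall t i, measurable_fun setT (X t i)) ->
  (forall t (B : set Theta), measurable (th t @^-1` B)) ->
  (forall t, measurable_fun setT (tau t)) ->
  (* GRE-SH: theta_1 is the given initial parameter *)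
  (forall w, th 1%N w = theta1) ->
  (* q t i w = q_i(H_{t-1}) is a distribution depending only on H_{t-1} *)
  (forall t i (B : set R), (2 <= t)%N -> measurable B ->
     meas_wrt (hist_sigma Rw th tau t.-1) (fun w => fine (q t i w B))) ->
  (* given H_{t-1}, the X_t(i) are independent across i, X_t(i) ~ q_i(H_{t-1}) *)
  (forall t (A : set Omega) (B : Theta -> set R), (2 <= t)%N ->
     hist_sigma Rw th tau t.-1 A -> (forall i, measurable (B i)) ->
     P (A `&` \bigcap_(i in [set: Theta]) (X t i @^-1` B i)) =
     (\int[P]_(w in A) (\prod_(i : Theta) fine (q t i w (B i)))%:E)%E) ->
  (* theta_t is a maximiser of X_t(.) for t >= 2 (any tie-breaking) *)
  (forall t w i, (2 <= t)%N -> X t i w <= X t (th t w) w) ->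
  (* tau_t ~ p_{theta_t} given H_{t-1}, X_t, theta_t *)
  (forall t (A : set Omega) (C : set T), (1 <= t)%N ->
     pre_tau_sigma Rw th tau X t A -> measurable C ->
     P (A `&` tau t @^-1` C) = (\int[P]_(w in A) p (th t w) C)%E) ->
  (* pc t i is (a version of) P(theta_t = i | H_{t-1}) *)
  (forall t i, (2 <= t)%N ->
     meas_wrt (hist_sigma Rw th tau t.-1) (pc t i) /\
     (forall w, 0 <= pc t i w <= 1) /\
     (forall A, hist_sigma Rw th tau t.-1 A ->
        (\int[P]_(w in A) (pc t i w)%:E)%E = P (A `&` th t @^-1` [set i]))) ->
  1 < alpha ->
  let J := Jval p Rw in
  let Delta i := J thstar - J i in
  (* Q_t(i, z) = P(X_t(i) >= z | H_{t-1}) *)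
  let Q t i (z : R) w := fine (q t i w `[z, +oo[%classic) in
  let Tn i w := (\sum_(1 <= t < n.+1) (th t w == i))%N in
  let a i := (\int[P]_w
        (\sum_(2 <= t < n.+1)
           (if Q t thstar (zeta i) w == 0 then 1
            else Num.min (((Q t thstar (zeta i) w)^-1 - 1) * pc t thstar w) 1))%:E)%E in
  let b i := ((\int[P]_w
        (\sum_(2 <= t < n.+1)
           (if (t%:R `^ (- alpha) < Q t i (zeta i) w) then pc t i w else 0))%:E)
        + ((alpha - 1)^-1)%:E)%E in
  (\int[P]_w (\sum_(1 <= t < n.+1) Delta (th t w))%:E)%E =
    (\sum_(i | i != thstar) (Delta i)%:E * \int[P]_w ((Tn i w)%:R)%:E)%E /\
  ((\int[P]_w (\sum_(1 <= t < n.+1) Delta (th t w))%:E)%E <=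
    (Delta theta1)%:E + \sum_(i | i != thstar) (Delta i)%:E * (a i + b i))%E.
Proof.
move=> mRw Rw01 Jmax Juniq mX mth mtau th1 mq indep argmax _ pcP a1 J Delta Q Tn
  a b.
have Delta0 i : 0 <= Delta i by rewrite subr_ge0.
have Deltastar : Delta thstar = 0 by exact: subrr.
have mind t i : measurable_fun setT (fun w => (th t w == i)%:R : R).
  by rewrite indicator_preimage1; apply: measurable_indic; exact: mth.
have mTn i : measurable_fun setT (fun w => (Tn i w)%:R : R).
  under eq_fun do rewrite /Tn natr_sum.
  exact: measurable_sum.
have regretE : (\int[P]_w (\sum_(1 <= t < n.+1) Delta (th t w))%:E =
    \sum_(i | i != thstar) (Delta i)%:E * \int[P]_w ((Tn i w)%:R)%:E)%E.
  transitivity (\int[P]_w (\sum_(i <- enum [pred i | i != thstar])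
      (Delta i)%:E * ((Tn i w)%:R)%:E))%E.
    apply: eq_integral => w _; rewrite big_enum -sumEFin.
    rewrite (eq_bigr (fun t : nat =>
      \sum_(i | i != thstar) (Delta i)%:E * ((th t w == i)%:R : R)%:E)%E).
      rewrite exchange_big; apply: eq_bigr => i _ /=.
      by rewrite /Tn natr_sum -sumEFin ge0_sume_distrr//.
    move=> t _; have [->|tht] := eqVneq (th t w) thstar.
      rewrite Deltastar big1// => i /negbTE istar.
      by rewrite eq_sym istar mule0.
    rewrite (bigD1 (th t w))//= eqxx mule1 big1 ?adde0// => i /andP[_ /negbTE].
    by rewrite eq_sym => ->; rewrite mule0.
  rewrite ge0_integral_sum//.
  - rewrite big_enum; apply: eq_bigr => i _.
    by rewrite ge0_integralZl_EFin//; exact/measurable_EFinP.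
  - by move=> i; apply: measurable_funeM; exact/measurable_EFinP.
  by move=> i w _; rewrite mule_ge0// lee_fin.
split=> //; rewrite regretE.
have mtH t : hist_sigma Rw th tau t `<=` measurable.
  exact: hist_sigma_measurable.
have Q01 t i z w : 0 <= Q t i z w <= 1 by exact: fine_probability_ge0_le1.
have mQ t i z : (2 <= t)%N -> measurable_fun setT (Q t i z).
  by move=> t2; apply: (meas_wrt_measurable (mtH t.-1)); exact: mq.
have mpc t i : (2 <= t)%N -> measurable_fun setT (pc t i).
  by move=> t2; apply: (meas_wrt_measurable (mtH t.-1)); case: (pcP t i t2).
have pc01 t i w : (2 <= t)%N -> 0 <= pc t i w <= 1.
  by move=> /(pcP t i)[_ [+ _]]; exact.
have countE i : (\int[P]_w ((Tn i w)%:R)%:E =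
    \sum_(1 <= t < n.+1) P (th t @^-1` [set i]))%E.
  under eq_integral do rewrite /Tn natr_sum.
  rewrite ge0_integral_sum_nat//; apply: eq_bigr => t _.
  under eq_integral do
    rewrite -[(_ == _)%:R]/((fun w => (th t w == i)%:R) _) indicator_preimage1.
  by rewrite integral_indic// setIT.
have tail i : (\sum_(2 <= t < n.+1) P (th t @^-1` [set i]) <= a i + b i)%E.
  rewrite /a /b !ge0_integral_sum_nat; last 4 first.
  - move=> t t2; apply: measurable_fun_ifT; last exact: measurable_cst.
      by apply: measurable_fun_ltr; [exact: measurable_cst|exact: mQ].
    exact: mpc.
  - by move=> t w t2; case: ifP => // _; case/andP: (pc01 t i w t2).
  - move=> t t2; apply: measurable_min_odds; [|exact: mQ|exact: mpc].
    by move=> w; case/andP: (Q01 t thstar (zeta i) w).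
  - move=> t w t2; apply: min_odds_ge0 => //.
    by case/andP: (pc01 t thstar w t2).
  apply: (@le_trans _ _ (\sum_(2 <= t < n.+1)
      (\int[P]_w (if Q t thstar (zeta i) w == 0 then 1
         else Num.min (((Q t thstar (zeta i) w)^-1 - 1) * pc t thstar w) 1)%:E +
      (\int[P]_w (if t%:R `^ (- alpha) < Q t i (zeta i) w
                  then pc t i w else 0)%:E + (t%:R `^ (- alpha))%:E)))%E).
    rewrite big_nat_cond [leRHS]big_nat_cond.
    apply: lee_sum => t /andP[/andP[t2 _] _].
    apply: (@selected_prob_le _ _ _ _ P (hist_gen Rw th tau t.-1) (q t) (X t)
      (th t) (pc t)) => //.
    + exact: mtH.
    + by move=> j B mB; exact: mq.
    + by move=> A B GA mB; exact: indep.
    + by move=> w j; exact: argmax.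
    + by move=> j; case: (pcP t j t2).
    + by move=> j w; exact: pc01.
    + by move=> j; case: (pcP t j t2) => _ [].
  rewrite !big_split/= leeD2l// leeD2l// sumEFin lee_fin.
  exact: sum_powRN_le.
have count_le i : (\int[P]_w ((Tn i w)%:R)%:E <=
    ((theta1 == i)%:R)%:E + (a i + b i))%E.
  rewrite countE; apply: le_trans (leeD2l _ (tail i)).
  have [n0|n0] := posnP n; first by rewrite n0 !big_geq// adde0 lee_fin.
  rewrite big_ltn//= leeD2r//.
  rewrite (_ : _ @^-1` _ = if theta1 == i then setT else set0).
    by case: ifP => _; rewrite ?probability_setT ?measure0.
  by apply/seteqP; split=> w; rewrite /= th1; case: eqP.
apply: (@le_trans _ _ (\sum_(i | i != thstar)
    ((Delta i * (theta1 == i)%:R)%:E + (Delta i)%:E * (a i + b i)))%E).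
  apply: lee_sum => i _.
  apply: (le_trans (lee_wpmul2l _ (count_le i))); first by rewrite lee_fin.
  rewrite ge0_muleDr ?lee_fin// ?EFinM//.
  by apply: le_trans (tail i); rewrite sume_ge0.
rewrite big_split/= leeD2r// sumEFin lee_fin.
have [->|ne] := eqVneq theta1 thstar.
  by rewrite Deltastar big1// => i; rewrite eq_sym => /negbTE ->; rewrite mulr0.
rewrite (bigD1 theta1)//= eqxx mulr1 big1 ?addr0// => i /andP[_].
by rewrite eq_sym => /negbTE ->; rewrite mulr0.
Qed.
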